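(* Let $(L_n)_{n\ge1}$ be a sequence of positive integers and $(\lambda_n)_{n\ge1}$ a sequence of real numbers in $(0,1]$, and let $\nu=\nu(L_n,\lambda_n)$ be the associated product probability measure on $X=\prod_{k\ge1}\{0,1\}$. If $$\sup\{L_n\lambda_n : n\ge1\}=\infty,$$ then the natural action of $S_\infty$ on $(X,\nu)$ is approximately transitive (AT).
   Context: For $0<\lambda\le1$, $\nu_\lambda$ is the probability measure on $\{0,1\}$ with $\nu_\lambda(0)=\frac1{1+\lambda}$, $\nu_\lambda(1)=\frac{\lambda}{1+\lambda}$. Identify $X=\prod_{k\ge1}\{0,1\}=\prod_{n\ge1}\prod_{1}^{L_n}\{0,1\}$ and set $\nu(L_n,\lambda_n)=\otimes_{n\ge1}\nu_{\lambda_n}^{\otimes L_n}$; that is, with $k_0=0$ and $k_n=L_1+\dots+L_n$, the factor at coordinate $i$ is $\nu_{\lambda_n}$ whenever $k_{n-1}<i\le k_n$. $S_\infty=\bigcup_{k\ge1}S_k$ is the group of finite permutations of $\mathbb{N}=\{1,2,3,\dots\}$. Its natural action on $X$ associates to $\sigma\in S_\infty$ the non-singular automorphism $\sigma(x_1,x_2,\dots)=(x_{\sigma(1)},x_{\sigma(2)},\dots)$ of $(X,\nu)$. Approximate transitivity: an action $\alpha$ of a Borel group $G$ by non-singular automorphisms of a Lebesgue measure space $(Y,\nu)$ is approximately transitive (AT) if for every $n<\infty$, all $f_1,\dots,f_n\in L^1_+(Y,\nu)$ (nonnegative integrable functions) and every $\varepsilon>0$, there exist $f\in L^1_+(Y,\nu)$,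 finitely many elements $g_1,\dots,g_m\in G$, and reals $\lambda_{j,k}\ge 0$ ($1\le j\le n$, $1\le k\le m$) such that $$\Big\|f_j-\sum_{k=1}^m\lambda_{j,k}\,\beta_{g_k}(f)\Big\|\le\varepsilon,\qquad j=1,\dots,n,$$ where $\|\cdot\|$ is the $L^1(Y,\nu)$ norm and $\beta_g(f)(y)=f(\alpha_g^{-1}y)\,\frac{d(\nu\circ\alpha_g^{-1})}{d\nu}(y)$, with $(\nu\circ\alpha_g^{-1})(A)=\nu(\alpha_g^{-1}A)$. (Only the family of automorphisms $\{\alpha_g\}$ matters in this definition.) *)

(* Defs.v *)
From HB Require Import structures.
From mathcomp Require Import all_boot all_order all_algebra.
From mathcomp Require Import all_classical all_reals all_analysis.

Set Implicit Arguments.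
Unset Strict Implicit.
Unset Printing Implicit Defensive.

Import Order.TTheory GRing.Theory Num.Theory.
Import numFieldNormedType.Exports.

Local Open Scope classical_set_scope.
Local Open Scope ring_scope.

Definition finitary : pred (nat -> nat) := fun s =>
  `[< bijective s /\ exists k, forall i, (k <= i)%N -> s i = i >].

(* Coordinates are numbered from 0; [S_k] is the set of bijections fixing every
   [i >= k], so that this type is the union of the [S_k]. *)
Record Sinf := MkSinf { Sinf_val :> nat -> nat ; _ : finitary Sinf_val }.

HB.instance Definition _ := [isSub for Sinf_val].
HB.instance Definition _ := [Choice of Sinf by <:].

Lemma finitary_id : finitary id.
Proof. by apply/asboolP; split; [exists id | exists 0%N]. Qed.

Lemma finitary_comp s t : finitary s -> finitary t -> finitary (t \o s).
Proof.
move=> /asboolP[bs [k sk]] /asboolP[bt [l tl]]; apply/asboolP; split.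
  exact: bij_comp.
exists (maxn k l) => i; rewrite geq_max => /andP[ki li] /=.
by rewrite sk// tl.
Qed.

Lemma finitary_inv (s : Sinf) : exists t : Sinf, cancel s t /\ cancel t s.
Proof.
case: s => s /= fs; have /asboolP[[t st ts] [k sk]] := fs.
have ft : finitary t.
  apply/asboolP; split; first by exists s.
  by exists k => i ki; rewrite -[in LHS](sk _ ki) st.
by exists (MkSinf ft).
Qed.

Definition Sinf_one := MkSinf finitary_id.

(* Products are read from left to right, as for [{perm T}] in MathComp:
   [(s * t) i = t (s i)]. *)
Definition Sinf_mul (s t : Sinf) := MkSinf (finitary_comp (valP s) (valP t)).

Definition Sinf_inv (s : Sinf) : Sinf := sval (cid (finitary_inv s)).

Lemma Sinf_mulA : associative Sinf_mul.
Proof. by move=> s t u; apply: val_inj. Qed.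

Lemma Sinf_mul1 : left_id Sinf_one Sinf_mul.
Proof. by move=> s; apply: val_inj. Qed.

Lemma Sinf_mul_one : right_id Sinf_one Sinf_mul.
Proof. by move=> s; apply: val_inj. Qed.

Lemma Sinf_mulV : left_inverse Sinf_one Sinf_inv Sinf_mul.
Proof.
move=> s; apply: val_inj; apply/funext => i /=.
by rewrite /Sinf_inv; case: cid => t [st ts] /=; exact: ts.
Qed.

Lemma Sinf_mul_inv : right_inverse Sinf_one Sinf_inv Sinf_mul.
Proof.
move=> s; apply: val_inj; apply/funext => i /=.
by rewrite /Sinf_inv; case: cid => t [st ts] /=; exact: st.
Qed.

HB.instance Definition _ := isGroup.Build Sinf
  Sinf_mulA Sinf_mul1 Sinf_mul_one Sinf_mulV Sinf_mul_inv.

Section approximate_transitivity.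
Context (R : realType) d (T : measurableType d) (P : probability T R).
Context (G : groupType) (act : G -> {mfun T >-> T}).

Definition nonsingular_action : Prop :=
  [/\ forall x, act 1%g x = x,
      forall g h x, act (g * h)%g x = act g (act h x) &
      forall g, pushforward P (act g) `<< P /\ P `<< pushforward P (act g)].

(* [distribution P (act g)] maps [A] to [P (act g @^-1` A)], so it is the image
   measure [P \o (act g)^-1]. *)
Definition beta (g : G) (f : T -> R) (y : T) : \bar R :=
  ((f (act g^-1%g y))%:E *
   Radon_Nikodym (charge_of_finite_measure (distribution P (act g))) P y)%E.

Definition L1_plus (f : T -> R) : Prop :=
  (forall y, 0 <= f y) /\ P.-integrable [set: T] (EFin \o f).

Definition approximately_transitive : Prop :=
  nonsingular_action /\
  forall (n : nat) (f_ : 'I_n -> T -> R) (eps : R),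
    (forall j, L1_plus (f_ j)) -> 0 < eps ->
  exists (f : T -> R) (m : nat) (g_ : 'I_m -> G) (lam : 'I_n -> 'I_m -> R),
    [/\ L1_plus f,
        forall j k, 0 <= lam j k &
        forall j, ('N[P]_1 [ (fun y => (f_ j y)%:E -
                      \sum_(k < m) (lam j k)%:E * beta (g_ k) f y) ]
                   <= eps%:E)%E].

End approximate_transitivity.

Definition coordinate_sets : set (set (nat -> bool)) :=
  \bigcup_i preimage_set_system setT (fun x : nat -> bool => x i) measurable.

Definition binseq : Type := g_sigma_algebraType coordinate_sets.

HB.instance Definition _ := Measurable.on binseq.

Lemma measurable_coord (i : nat) :
  measurable_fun [set: binseq] (fun x : binseq => x i).
Proof.
move=> _ B mB; apply: sub_sigma_algebra.
by exists i => //; exists B.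
Qed.

Definition permute (s : Sinf) (x : binseq) : binseq := fun i => x (s i).

Lemma measurable_permute (s : Sinf) : measurable_fun [set: binseq] (permute s).
Proof.
apply: (@measurability _ _ binseq binseq setT (permute s) coordinate_sets) => //.
move=> _ [_ [i _ [B mB <-]] <-]; rewrite !setTI -comp_preimage.
by rewrite -[X in measurable X]setTI; exact: (measurable_coord (s i)).
Qed.

HB.instance Definition _ (s : Sinf) :=
  isMeasurableFun.Build _ _ binseq binseq (permute s) (measurable_permute s).

Definition natural_action (s : Sinf) : {mfun binseq >-> binseq} := permute s.

(* These values determine [P], the sets below being a generating pi-system;
   every subset of [bool] is measurable. *)
Definition is_product_measure (R : realType) (mu : nat -> probability bool R)
    (P : probability binseq R) : Prop :=
  forall (n : nat) (A : nat -> set bool),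
    P [set x : binseq | forall i, (i < n)%N -> A i (x i)] =
    (\prod_(i < n) mu i (A i))%E.

(* The values 0 and 1 of a coordinate are encoded as [false] and [true]. *)
Definition nu_factor (R : realType) (l : R) : probability bool R :=
  bernoulli_prob (l / (1 + l)).

Lemma nu_factorE (R : realType) (l : R) : 0 < l ->
  nu_factor l [set false] = (1 / (1 + l))%:E /\
  nu_factor l [set true] = (l / (1 + l))%:E.
Proof.
move=> l0; have l1 : 0 < 1 + l by rewrite addr_gt0.
have p01 : 0 <= l / (1 + l) <= 1.
  by rewrite divr_ge0 ?(ltW l0) ?(ltW l1)//= ler_pdivrMr// mul1r lerDr.
rewrite /= /bernoulli_prob p01 !fsbig_set1/=; split => //; congr (_%:E).
by rewrite -[X in X - _](divff (lt0r_neq0 l1)) -mulrBl addrK.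
Qed.

(* With blocks and coordinates numbered from 0, the block [n] consists of the
   coordinates [i] with [\sum_(m < n) L m <= i < \sum_(m < n.+1) L m]. *)
Definition block (L : nat -> nat) (i : nat) : nat :=
  find (fun n => i < \sum_(m < n.+1) L m)%N (iota 0 i.+1).

Lemma blockP (L : nat -> nat) (n i : nat) : (forall m, 0 < L m)%N ->
  (\sum_(m < n) L m <= i < \sum_(m < n.+1) L m)%N -> block L i = n.
Proof.
move=> L0 /andP[ni iSn].
have Lmono a b : (a <= b)%N -> (\sum_(m < a) L m <= \sum_(m < b) L m)%N.
  move=> ab; rewrite -(subnKC ab) big_split_ord/=; exact: leq_addr.
have Lge a : (a <= \sum_(m < a) L m)%N.
  elim: a => // a IH; rewrite big_ord_recr/= -addn1.
  by rewrite leq_add.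
have ni' : (n < i.+1)%N by rewrite ltnS (leq_trans (Lge n)).
rewrite /block; set a := fun _ => _.
have an : a n by [].
have hasa : has a (iota 0 i.+1).
  by apply/hasP; exists n => //; rewrite mem_iota.
have fs : (find a (iota 0 i.+1) < i.+1)%N.
  by rewrite -[X in (_ < X)%N](size_iota 0 i.+1) -has_find.
apply/eqP; rewrite eqn_leq; apply/andP; split.
  rewrite leqNgt; apply/negP => /(before_find 0%N).
  by rewrite nth_iota// add0n an.
rewrite leqNgt; apply/negP => fn.
have := nth_find 0%N hasa; rewrite nth_iota// add0n /a => iF.
by have := leq_trans iF (leq_trans (Lmono _ _ fn) ni); rewrite ltnn.
Qed.

Definition is_nu (R : realType) (L : nat -> nat) (lambda : nat -> R)
    (P : probability binseq R) : Prop :=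
  is_product_measure (fun i => nu_factor (lambda (block L i))) P.

(* Main.v *)
Require Import Defs.
From mathcomp Require Import all_boot all_order all_algebra all_fingroup.
From mathcomp Require Import all_classical all_reals all_analysis.
From mathcomp Require Import measurable_realfun ring lra.

(* Cylinder functions are dense in L^1_+, so it suffices to approximate the
   normalized indicators of all the cylinders [a], with a in {0,1}^N, from one f.
   In a far block with L_n lambda_n large, reserve for each i < N a sub-block of m
   coordinates, and let f nu be nu conditioned on x_i = 0 and on the first
   coordinate of the i-th sub-block being 1, for all i < N. A finite permutation
   exchanging coordinate i with the latter where a_i = 1, and then moving the
   remaining conditioned coordinate to place k_i of its sub-block, turns f nu into
   nu conditioned on x_i = a_i and on x = 1 - a_i at place k_i. Averaging over all
   (k_i), the density becomes that of nu conditioned on [a] times a product over i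
   of empirical means of m independent variables of mean 1 and variance at most
   2/lambda_n; since m lambda_n is large, the product is close to 1 in L^2, by the
   weak law of large numbers. *)

Set Implicit Arguments.
Unset Strict Implicit.
Unset Printing Implicit Defensive.

Import Order.TTheory GRing.Theory Num.Theory.
Local Open Scope classical_set_scope.
Local Open Scope ring_scope.

(** * Finite sets of coordinates and the permutations supported on them *)

Lemma prod_image (R : comNzRingType) (T : finType) (e : T -> nat) (n : nat)
    (F : nat -> R) :
  injective e -> (forall t, e t < n)%N ->
  (forall i, (forall t, e t != i) -> F i = 1) ->
  \prod_(i < n) F i = \prod_t F (e t).
Proof.
move=> ei en F1; pose h t : 'I_n := Ordinal (en t).
have hi : injective h by move=> s t /(congr1 val)/= /ei.
rewrite (bigID (fun i => i \in h @: [set: T]%SET))/=.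
rewrite [X in _ * X]big1 ?mulr1; last first.
  move=> i /negP hi'; apply: F1 => t; apply/eqP => eti; apply: hi'.
  by apply/imsetP; exists t => //; apply: val_inj.
rewrite big_imset/=; last by move=> ? ? _ _; exact: hi.
by apply: eq_bigl => t; rewrite inE.
Qed.

Lemma Sinf_bound (g : Sinf) : exists k, forall i, (k <= i)%N -> g i = i.
Proof. by case: g => g /= /asboolP[_]. Qed.

Lemma Sinf_inj (g : Sinf) : injective g.
Proof. by case: g => g /= /asboolP[/bij_inj]. Qed.

Lemma Sinf_K (g : Sinf) : cancel g (Sinf_inv g).
Proof. by move=> i; have := congr1 (fun h : Sinf => h i) (Sinf_mul_inv g). Qed.

Lemma Sinf_restrict (g : Sinf) (n : nat) : (forall i, (n <= i)%N -> g i = i) ->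
  exists s : {perm 'I_n}, forall i : 'I_n, g i = s i.
Proof.
move=> gn; have gl (i : 'I_n) : (g i < n)%N.
  rewrite ltnNge; apply/negP => ngi; have /Sinf_inj gii := gn _ ngi.
  by have := ltn_ord i; rewrite -gii ltnNge ngi.
pose h i : 'I_n := Ordinal (gl i).
have hi : injective h by move=> i j /(congr1 val)/= /Sinf_inj /val_inj.
by exists (perm hi) => i; rewrite permE.
Qed.

(** Extension by the identity off the image of [e]; the extension of the inverse permutation inverts
    it. This turns rearrangements of a finite index set into elements of the group. *)
Lemma Sinf_extend (T : finType) (e : T -> nat) (s : {perm T}) : injective e ->
  exists g : Sinf, (forall t, g (e t) = e (s t)) /\
                   (forall i, (forall t, e t != i) -> g i = i).
Proof.
move=> ei; pose h (s : {perm T}) i :=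
  if [pick t | e t == i] is Some t then e (s t) else i.
have hE u t : h u (e t) = e (u t).
  rewrite /h; case: pickP => [t' /eqP/ei->//|/(_ t)]; by rewrite eqxx.
have hN u i : (forall t, e t != i) -> h u i = i.
  by move=> ni; rewrite /h; case: pickP => // t /eqP eti; move: (ni t); rewrite eti eqxx.
have hK (u v : {perm T}) : (forall t, v (u t) = t) -> cancel (h u) (h v).
  move=> uv i; have [[t <-]|ni] := pselect (exists t, e t = i).
    by rewrite !hE uv.
  have ni' t : e t != i by apply/eqP => eti; apply: ni; exists t.
  by rewrite (hN u)// hN.
have fh : finitary (h s).
  apply/asboolP; split.
    by exists (h s^-1%g); apply: hK => t; rewrite ?permK ?permKV.
  exists (\max_t (e t)).+1 => i li; apply: hN => t; apply/eqP => eti.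
  by move: li; rewrite -eti ltnNge leq_bigmax.
by exists (MkSinf fh); split=> [t|i]; [exact: hE|exact: hN].
Qed.

(** * Functions of finitely many coordinates and their expectations *)

Definition trace (T : finType) (e : T -> nat) (x : binseq) : {ffun T -> bool} :=
  [ffun t => x (e t)].

Section cylinder.
Context (T : finType) (e : T -> nat).

Lemma measurable_preimage_trace (S : set {ffun T -> bool}) :
  measurable (trace e @^-1` S).
Proof.
have -> : trace e @^-1` S = \bigcup_(w in S) \bigcap_(t in [set: T])
    ((fun x : binseq => x (e t)) @^-1` [set w t]).
  apply/seteqP; split=> [x Sx|x [w Sw xw]].
    by exists (trace e x) => // t _; rewrite /= ffunE.
  suff -> : (trace e @^-1` S) x = S w by [].
  by congr (S _); apply/ffunP => t; rewrite ffunE; exact: (xw t I).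
apply: fin_bigcup_measurable => // w _.
apply: fin_bigcap_measurable => // t _.
by rewrite -[X in measurable X]setTI; exact: measurable_coord.
Qed.

Lemma measurable_trace d (U : measurableType d) (H : {ffun T -> bool} -> U) :
  measurable_fun [set: binseq] (H \o trace e).
Proof.
by move=> _ B mB; rewrite setTI comp_preimage; exact: measurable_preimage_trace.
Qed.

End cylinder.

Section mean.
Context (R : realType) (q : nat -> bool -> R).
Context (T : finType) (e : T -> nat).
Implicit Types H : {ffun T -> bool} -> R.

(** For injective [e] this is the law of [trace e] under the product measure, and [mean] is then the
    corresponding expectation. *)
Definition weight (w : {ffun T -> bool}) : R := \prod_t q (e t) (w t).

Definition mean H : R := \sum_w weight w * H w.

(** Independence of the coordinates, obtained by expanding a product of sums. *)
Lemma mean_prod (psi : T -> bool -> R) :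
  mean (fun w => \prod_t psi t (w t)) = \prod_t \sum_b q (e t) b * psi t b.
Proof.
rewrite /mean bigA_distr_bigA/=.
by apply: eq_bigr => w _; rewrite /weight -big_split.
Qed.

Lemma meanZ k H : mean (fun w => k * H w) = k * mean H.
Proof. by rewrite /mean big_distrr; apply: eq_bigr => w _; rewrite mulrCA. Qed.

Lemma meanD H H' : mean (fun w => H w + H' w) = mean H + mean H'.
Proof. by rewrite /mean -big_split; apply: eq_bigr => w _; rewrite mulrDr. Qed.

Lemma mean_sum (I : finType) (H : I -> {ffun T -> bool} -> R) :
  mean (fun w => \sum_i H i w) = \sum_i mean (H i).
Proof.
by rewrite exchange_big; apply: eq_bigr => w _; rewrite big_distrr.
Qed.

End mean.

Section product_measure.
Context (R : realType) (q : nat -> bool -> R) (P : probability binseq R).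
Hypothesis q_gt0 : forall i b, 0 < q i b.
Hypothesis q_sum1 : forall i, \sum_b q i b = 1.
Hypothesis PE : forall n (A : nat -> pred bool),
  P [set x | forall i, (i < n)%N -> A i (x i)] =
  (\prod_(i < n) \sum_(b | A i b) q i b)%:E.

Lemma weight_ge0 (T : finType) (e : T -> nat) w : 0 <= weight q e w.
Proof. by apply: prodr_ge0 => t _; exact: ltW. Qed.

Lemma le_mean (T : finType) (e : T -> nat) (H H' : {ffun T -> bool} -> R) :
  (forall w, H w <= H' w) -> mean q e H <= mean q e H'.
Proof. by move=> HH; apply: ler_sum => w _; rewrite ler_wpM2l// weight_ge0. Qed.

Lemma mean_cst (T : finType) (e : T -> nat) (k : R) : mean q e (fun=> k) = k.
Proof.
have m1 : mean q e (fun=> 1) = 1.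
  transitivity (mean q e (fun w => \prod_(t : T) 1)).
    by congr mean; apply/funext => w; rewrite big1.
  rewrite (mean_prod q e (fun _ _ => 1)) big1// => t _.
  by under eq_bigr do rewrite mulr1; exact: q_sum1.
have -> : (fun=> k) = (fun w : {ffun T -> bool} => k * 1).
  by apply/funext => w; rewrite mulr1.
by rewrite meanZ m1 mulr1.
Qed.

Section trace_injective.
Context (T : finType) (e : T -> nat) (e_inj : injective e).

Lemma probability_trace w : P (trace e @^-1` [set w]) = (weight q e w)%:E.
Proof.
pose n := (\max_t (e t)).+1.
have en t : (e t < n)%N by rewrite ltnS leq_bigmax.
(* The constraint is the single value [w t] at the coordinate [e t], and void off the image of [e],
   where the factor is the total mass 1. *)
pose A i : pred bool := fun b => [forall t, (e t == i) ==> (b == w t)].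
have -> : trace e @^-1` [set w] =
    [set x : binseq | forall i, (i < n)%N -> A i (x i)].
  apply/seteqP; split=> [x /= xw i _|x /= xA].
    by apply/forallP => t; apply/implyP => /eqP <-; rewrite -xw ffunE.
  apply/ffunP => t; rewrite ffunE; apply/eqP.
  by have /forallP/(_ t) := xA _ (en t); rewrite eqxx.
rewrite (PE n A); congr (_%:E); 
rewrite (prod_image (F := fun i => \sum_(b | A i b) q i b) e_inj en).
  apply: eq_bigr => t _; rewrite (big_pred1 (w t))// => b.
  apply/forallP/eqP => [/(_ t)|-> u]; first by rewrite eqxx => /eqP.
  by apply/implyP => /eqP/e_inj ->.
move=> i ni; rewrite -[RHS](q_sum1 i); apply: eq_bigl => b.
by apply/forallP => t; rewrite (negbTE (ni t)).
Qed.

Lemma traceE (H : {ffun T -> bool} -> R) (x : binseq) :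
  H (trace e x) = \sum_w H w * \1_(trace e @^-1` [set w]) x.
Proof.
rewrite (bigD1 (trace e x))//= big1 => [|w wx].
  by rewrite addr0 indicE mem_set ?mulr1.
by rewrite indicE memNset ?mulr0//= => xw; rewrite xw eqxx in wx.
Qed.

Lemma integrable_trace (H : {ffun T -> bool} -> R) :
  P.-integrable [set: binseq] (fun x => (H (trace e x))%:E).
Proof.
have -> : (fun x : binseq => (H (trace e x))%:E) = (fun x : binseq =>
    \sum_w (H w)%:E * (\1_(trace e @^-1` [set w]) x)%:E)%E.
  by apply/funext => x; rewrite traceE -sumEFin; apply: eq_bigr.
apply: integrable_sum => // w _; apply: integrableZl => //.
by apply: integrable_indic; exact: measurable_preimage_trace.
Qed.

(** Splitting along the finitely many words turns the integral into a finite sum. *)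
Lemma integral_trace (H : {ffun T -> bool} -> R) :
  (\int[P]_x (H (trace e x))%:E)%E = (mean q e H)%:E.
Proof.
have mt w := @measurable_preimage_trace T e [set w].
have int1 w : P.-integrable [set: binseq]
    (fun x => (\1_(trace e @^-1` [set w]) x)%:E).
  exact: integrable_indic.
under eq_integral => x _ do rewrite traceE -sumEFin.
rewrite (integral_sum _ (f := fun w x =>
  ((H w)%:E * (\1_(trace e @^-1` [set w]) x)%:E)%E))//; last first.
  by move=> w; exact: integrableZl.
rewrite -sumEFin; apply: eq_bigr => w _.
rewrite integralZl// integral_indic// setIT mulrC EFinM.
by congr (_ * _)%E; exact: probability_trace.
Qed.

End trace_injective.
End product_measure.

(** * Cylinder sets as a generating pi-system *)

Definition depends_on (n : nat) (A : set binseq) : Prop :=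
  forall x y : binseq, (forall i, (i < n)%N -> x i = y i) -> A x -> A y.

Definition cylinders : set (set binseq) := [set A | exists n, depends_on n A].

(** A right inverse of [trace] on the first [n] coordinates, padding with [false]; it turns a set
    depending on these coordinates into a set of finite words. *)
Definition extend (n : nat) (w : {ffun 'I_n -> bool}) : binseq :=
  fun i => if insub i is Some j then w j else false.

Lemma depends_onW n m A : (n <= m)%N -> depends_on n A -> depends_on m A.
Proof.
by move=> nm nA x y xy; apply: nA => i iln; apply: xy; exact: leq_trans nm.
Qed.

Lemma extend_ord n (w : {ffun 'I_n -> bool}) (i : 'I_n) : extend w i = w i.
Proof. by rewrite /extend valK. Qed.

Lemma extend_trace n (x : binseq) i : (i < n)%N ->
  extend (trace (@nat_of_ord n) x) i = x i.
Proof.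
by move=> iln; rewrite (extend_ord _ (Ordinal iln)) ffunE.
Qed.

Lemma depends_on_trace n A : depends_on n A ->
  A = trace (@nat_of_ord n) @^-1` [set w | A (extend w)].
Proof.
move=> nA; apply/seteqP; split=> x /=.
  by apply: nA => i iln; rewrite extend_trace.
by apply: nA => i iln; rewrite extend_trace.
Qed.

Lemma cylinders_setI : setI_closed cylinders.
Proof.
move=> A B [m mA] [n nB]; exists (maxn m n).
have := depends_onW (leq_maxl m n) mA; have := depends_onW (leq_maxr m n) nB.
by move=> dB dA x y xy [Ax Bx]; split; [exact: dA Ax|exact: dB Bx].
Qed.

Lemma measurable_cylinders : (measurable : set (set binseq)) = <<s cylinders >>.
Proof.
apply/seteqP; split=> A.
  apply: smallest_sub; first exact: smallest_sigma_algebra.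
  move=> _ [i _ [B _ <-]]; apply: sub_gen_smallest.
  by exists i.+1 => x y xy; rewrite /= xy.
apply: smallest_sub; first exact: sigma_algebra_measurable.
move=> B [n /depends_on_trace ->]; exact: measurable_preimage_trace.
Qed.

(** * Image of a product measure under a finite permutation *)

Section density.
Context (R : realType) (q : nat -> bool -> R) (P : probability binseq R).
Hypothesis q_gt0 : forall i b, 0 < q i b.
Hypothesis q_sum1 : forall i, \sum_b q i b = 1.
Hypothesis PE : forall n (A : nat -> pred bool),
  P [set x | forall i, (i < n)%N -> A i (x i)] =
  (\prod_(i < n) \sum_(b | A i b) q i b)%:E.

Let q_neq0 i b : q i b != 0. Proof. by rewrite gt_eqF. Qed.

(** Under the image of [P] by [g], coordinate [i] has the law of coordinate [g i]. This is the
    likelihood ratio on the first [n] coordinates, hence the whole Radon-Nikodym derivative when [g]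
    fixes every [i >= n]. *)
Definition density (n : nat) (g : Sinf) (w : {ffun 'I_n -> bool}) : R :=
  \prod_(i < n) (q (g i) (w i) / q i (w i)).

Lemma densityW (g : Sinf) m n (x : binseq) : (m <= n)%N ->
  (forall i, (m <= i)%N -> g i = i) ->
  density g (trace (@nat_of_ord m) x) = density g (trace (@nat_of_ord n) x).
Proof.
move=> mn gm; pose F i := q (g i) (x i) / q i (x i).
have dE k : density g (trace (@nat_of_ord k) x) = \prod_(0 <= i < k) F i.
  by rewrite big_mkord; apply: eq_bigr => i _; rewrite ffunE.
rewrite !dE [RHS](big_cat_nat (n := m))//= [X in _ * X]big_nat_cond [X in _ * X]big1 ?mulr1//.
by move=> i /andP[/andP[/gm mi _] _]; rewrite /F mi divff.
Qed.

Lemma probability_preimage_cylinder (g : Sinf) n A :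
  (forall i, (n <= i)%N -> g i = i) -> cylinders A ->
  P (natural_action g @^-1` A) =
  (\int[P]_(x in A) (density g (trace (@nat_of_ord n) x))%:E)%E.
Proof.
(* On the first [m] coordinates both the permutation and the set are visible, so each side becomes a
   finite sum over words of length [m]. *)
move=> gn0 [n0 nA0]; pose m := maxn n n0.
have nA : depends_on m A by apply: depends_onW nA0; exact: leq_maxr.
have gm i : (m <= i)%N -> g i = i by rewrite geq_max => /andP[/gn0].
under eq_integral => x _ do rewrite (densityW _ (leq_maxl n n0) gn0) -/m.
have [s gs] := Sinf_restrict gm.
have vi : injective (@nat_of_ord m) by exact: val_inj.
have mA : measurable A by rewrite (depends_on_trace nA); exact: measurable_preimage_trace.
transitivity (\int[P]_x (\1_(natural_action g @^-1` A) x)%:E)%E.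
  rewrite integral_indic ?setIT// -[X in measurable X]setTI.
  exact: measurable_permute.
pose a (w : {ffun 'I_m -> bool}) : R := (extend w \in A)%:R.
have aE x : (x \in A)%:R = a (trace (@nat_of_ord m) x).
  congr ((nat_of_bool _)%:R); rewrite [in LHS](depends_on_trace nA).
  by apply/idP/idP; rewrite !inE.
transitivity (\int[P]_x (a [ffun i => trace (@nat_of_ord m) x (s i)])%:E)%E.
  apply: eq_integral => x _; rewrite indicE; congr (_%:E).
  transitivity ((natural_action g x \in A)%:R : R).
    by congr ((nat_of_bool _)%:R); apply/idP/idP; rewrite !inE.
  by rewrite aE; congr a; apply/ffunP => i; rewrite !ffunE -gs.
rewrite (integral_trace q_sum1 PE vi (fun w => a [ffun i => w (s i)])).
rewrite integral_mkcond.
transitivity (\int[P]_x (a (trace (@nat_of_ord m) x) *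
    density g (trace (@nat_of_ord m) x))%:E)%E; last first.
  apply: eq_integral => x _; rewrite patchE -aE.
  by case: ifP => _; rewrite ?mul1r// mul0r.
rewrite (integral_trace q_sum1 PE vi (fun w => a w * density g w)).
congr (_%:E); rewrite /mean.
pose h (w : {ffun 'I_m -> bool}) : {ffun 'I_m -> bool} := [ffun i => w (s i)].
pose h' (w : {ffun 'I_m -> bool}) : {ffun 'I_m -> bool} := [ffun i => w (s^-1%g i)].
(* Substituting the word rearranged by the inverse of [s] removes [s] from the argument of [a]; the
   weight of the rearranged word is the old weight times the density. *)
rewrite [LHS](reindex h'); last first.
  by exists h => w _; apply/ffunP => i; rewrite !ffunE ?permK ?permKV.
apply: eq_bigr => w _.
have -> : [ffun i => h' w (s i)] = w.
  by apply/ffunP => i; rewrite !ffunE permK.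
rewrite mulrCA mulrC; congr (_ * _).
rewrite /weight /density -big_split (reindex_inj (@perm_inj _ s))/=.
by apply: eq_bigr => i _; rewrite ffunE permK gs mulrC divfK.
Qed.

(** Both sides are finite measures in [A] that agree on cylinders, so they agree on the generated
    sigma-algebra by Dynkin's theorem. *)
Lemma probability_preimage (g : Sinf) n A :
  (forall i, (n <= i)%N -> g i = i) -> measurable A ->
  P (natural_action g @^-1` A) =
  (\int[P]_(x in A) (density g (trace (@nat_of_ord n) x))%:E)%E.
Proof.
move=> gn; rewrite measurable_cylinders.
have mg (B : set binseq) : measurable B -> measurable (natural_action g @^-1` B).
  by move=> mB; rewrite -[X in measurable X]setTI; exact: measurable_permute.
have D0 x : (0 <= (density g (trace (@nat_of_ord n) x))%:E)%E.
  by rewrite lee_fin; apply: prodr_ge0 => i _; rewrite divr_ge0// ltW.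
have mD : measurable_fun [set: binseq]
    (EFin \o (density g \o trace (@nat_of_ord n))).
  by apply/measurable_EFinP; exact: (measurable_trace _ (density g)).
(* The density has total mass 1, by the cylinder case for the whole space; the complement step needs
   this finiteness in order to subtract. *)
have T1 : (1 = \int[P]_x (density g (trace (@nat_of_ord n) x))%:E)%E.
  rewrite -(probability_preimage_cylinder gn) ?preimage_setT ?probability_setT//.
  by exists 0%N.
move: A; apply: dynkin_induction.
- exact: measurable_cylinders.
- exact: cylinders_setI.
- by rewrite preimage_setT probability_setT.
- by move=> A cA; exact: probability_preimage_cylinder.
- move=> A mA PA; rewrite preimage_setC probability_setC; last exact: mg.
  rewrite {}PA T1 -[in X in (X - _)%E](setUv A) ge0_integral_setU//; last 3 first.
  + exact: measurableC.
  + by rewrite setUv.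
  + exact/disj_setPCl.
  rewrite [X in (X - _)%E]addeC addeK//.
  rewrite ge0_fin_numE ?integral_ge0//.
  apply: le_lt_trans (ltry 1); rewrite T1.
  exact: ge0_subset_integral.
- move=> F mF tF PF; rewrite preimage_bigcup measure_bigcup//; last 2 first.
  + by move=> i _; exact: mg.
  + apply/trivIsetP => i j _ _ ij; rewrite -preimage_setI.
    by move/trivIsetP : tF => -> //; rewrite preimage_set0.
  rewrite ge0_integral_bigcup//; last exact: measurable_funTS.
  under [RHS]eq_eseriesr do rewrite -PF.
  by apply: eq_eseriesl => i; rewrite in_setT.
Qed.

End density.

(** * Nonsingularity of the action and its effect on densities *)

Section action.
Context (R : realType) (q : nat -> bool -> R) (P : probability binseq R).
Hypothesis q_gt0 : forall i b, 0 < q i b.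
Hypothesis q_sum1 : forall i, \sum_b q i b = 1.
Hypothesis PE : forall n (A : nat -> pred bool),
  P [set x | forall i, (i < n)%N -> A i (x i)] =
  (\prod_(i < n) \sum_(b | A i b) q i b)%:E.

Let q_neq0 i b : q i b != 0. Proof. by rewrite gt_eqF. Qed.

Lemma preimage_null (g : Sinf) (A : set binseq) : measurable A -> P A = 0%E ->
  P (natural_action g @^-1` A) = 0%E.
Proof.
move=> mA PA0; have [n gn] := Sinf_bound g.
rewrite (probability_preimage q_gt0 q_sum1 PE gn mA).
apply: null_set_integral => //.
apply: measurable_funTS; apply/measurable_EFinP.
exact: (measurable_trace _ (density q g)).
Qed.

Lemma pushforward_dominated (g : Sinf) :
  pushforward P (natural_action g) `<< P.
Proof.
apply/null_content_dominatesP => A mA PA0.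
exact: preimage_null.
Qed.

(** Null sets have null preimages under every [g]; applying this to the inverse of [g] gives the
    converse domination. *)
Lemma nonsingular_natural_action : nonsingular_action P natural_action.
Proof.
split=> // g; split; first exact: pushforward_dominated.
apply/null_content_dominatesP => A mA PA0.
have -> : A = natural_action (Sinf_inv g) @^-1` (natural_action g @^-1` A).
  apply/seteqP; split=> x /=; suff -> : natural_action g
    (natural_action (Sinf_inv g) x) = x by [].
  - by apply/funext => i; rewrite /= /permute Sinf_K.
  - by apply/funext => i; rewrite /= /permute Sinf_K.
apply: preimage_null => //.
by rewrite -[X in measurable X]setTI; exact: measurable_permute.
Qed.

Lemma Radon_Nikodym_natural_action (g : Sinf) n :
  (forall i, (n <= i)%N -> g i = i) ->
  ae_eq P [set: binseq]
    (Radon_Nikodym (charge_of_finite_measure (distribution P (natural_action g))) P)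
    (EFin \o (density q g \o trace (@nat_of_ord n))).
Proof.
move=> gn; have dom : charge_of_finite_measure
  (distribution P (natural_action g)) `<< P by exact: pushforward_dominated.
apply: integral_ae_eq => //.
- exact: Radon_Nikodym_integrable.
- by apply/measurable_EFinP; exact: (measurable_trace _ (density q g)).
- move=> E _ mE; rewrite -Radon_Nikodym_integral//.
  exact: (probability_preimage q_gt0 q_sum1 PE gn mE).
Qed.

Lemma measurable_beta (g : Sinf) (f : binseq -> R) :
  measurable_fun [set: binseq] f ->
  measurable_fun [set: binseq] (beta P natural_action g f).
Proof.
move=> mf; apply: emeasurable_funM.
  apply/measurable_EFinP; apply: (measurableT_comp mf).
  exact: measurable_permute.
apply: (measurable_int P); apply: Radon_Nikodym_integrable.
exact: pushforward_dominated.
Qed.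

(** On a product density, [g] merely permutes the one-coordinate weights [r]: the Jacobian cancels
    the denominators of the translated function and supplies those of the new positions. *)
Lemma beta_prod (T : finType) (e : T -> nat) (g : Sinf) (s : {perm T})
    (r : T -> bool -> R) :
  injective e -> (forall t, g (e t) = e (s t)) ->
  (forall i, (forall t, e t != i) -> g i = i) ->
  ae_eq P [set: binseq]
    (beta P natural_action g (fun x => \prod_t (r t (x (e t)) / q (e t) (x (e t)))))
    (fun x => (\prod_t (r (s t) (x (e t)) / q (e t) (x (e t))))%:E).
Proof.
move=> ei gs gN; pose n := (\max_t (e t)).+1.
have en t : (e t < n)%N by rewrite ltnS leq_bigmax.
have gn i : (n <= i)%N -> g i = i.
  move=> ni; apply: gN => t; apply/eqP => eti.
  by have := en t; rewrite eti ltnNge ni.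
apply: filterS (Radon_Nikodym_natural_action gn) => x Dx xT.
rewrite /beta (Dx I) -EFinM; congr (_%:E); rewrite [(_ \o _) x]/=.
have -> : density q g (trace (@nat_of_ord n) x) =
    \prod_t (q (e (s t)) (x (e t)) / q (e t) (x (e t))).
  pose F i := q (g i) (x i) / q i (x i).
  transitivity (\prod_(i < n) F i); first by apply: eq_bigr => i _; rewrite ffunE.
  rewrite (prod_image (F := F) ei en); last first.
    by move=> i ni; rewrite /F gN// divff.
  by apply: eq_bigr => t _; rewrite /F gs.
rewrite (reindex_inj (@perm_inj _ s))/= -big_split; apply: eq_bigr => t _ /=.
have -> : permute g^-1%g x (e (s t)) = x (e t).
  by rewrite /permute -gs; congr (x _); exact: Sinf_K.
by rewrite mulrA divfK.
Qed.

End action.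

Import HBSimple.

(** * Distance in $L^1$ *)

Section L1_distance.
Context d (T : measurableType d) (R : realType) (mu : measure T R).
Implicit Types f g h : T -> R.

Definition L1_dist f g : \bar R := (\int[mu]_x (`|f x - g x|)%:E)%E.

Lemma measurable_dist f g : measurable_fun [set: T] f ->
  measurable_fun [set: T] g ->
  measurable_fun [set: T] (fun x => (`|f x - g x|)%:E).
Proof.
move=> mf mg; apply/measurable_EFinP.
by apply: measurableT_comp => //; exact: measurable_funB.
Qed.

Lemma L1_dist_triangle f g h : measurable_fun [set: T] f ->
  measurable_fun [set: T] g -> measurable_fun [set: T] h ->
  (L1_dist f h <= L1_dist f g + L1_dist g h)%E.
Proof.
move=> mf mg mh; rewrite /L1_dist -ge0_integralD//; try exact: measurable_dist.
apply: ge0_le_integral => //; first exact: measurable_dist.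
  by apply: emeasurable_funD; exact: measurable_dist.
by move=> x _; rewrite -EFinD lee_fin ler_distD.
Qed.

Lemma L1_distD f f' g g' : measurable_fun [set: T] f ->
  measurable_fun [set: T] f' -> measurable_fun [set: T] g ->
  measurable_fun [set: T] g' ->
  (L1_dist (f \+ f')%R (g \+ g')%R <= L1_dist f g + L1_dist f' g')%E.
Proof.
move=> mf mf' mg mg'; rewrite /L1_dist -ge0_integralD//;
  try exact: measurable_dist.
apply: ge0_le_integral => //.
- by apply: measurable_dist; exact: measurable_funD.
- by apply: emeasurable_funD; exact: measurable_dist.
- move=> x _; rewrite -EFinD lee_fin/= opprD addrACA.
  exact: ler_normD.
Qed.

End L1_distance.

(** * Density in $L^1$ of the functions of finitely many coordinates *)

Section approximable.
Context (R : realType) (P : probability binseq R).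
Implicit Types f : binseq -> R.

Definition approximable f : Prop := forall eps : R, 0 < eps ->
  exists n (H : {ffun 'I_n -> bool} -> R),
    (L1_dist P f (H \o trace (@nat_of_ord n)) <= eps%:E)%E.

Lemma trace_widen n m (H : {ffun 'I_n -> bool} -> R) : (n <= m)%N ->
  exists H' : {ffun 'I_m -> bool} -> R,
    H \o trace (@nat_of_ord n) = H' \o trace (@nat_of_ord m).
Proof.
move=> nm; exists (fun w => H [ffun i => w (widen_ord nm i)]).
by apply/funext => x /=; congr H; apply/ffunP => i; rewrite !ffunE.
Qed.

Lemma approximable_trace n (H : {ffun 'I_n -> bool} -> R) :
  approximable (H \o trace (@nat_of_ord n)).
Proof.
move=> eps e0; exists n, H; rewrite /L1_dist.
by under eq_integral do rewrite subrr normr0; rewrite integral0 lee_fin ltW.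
Qed.

Lemma approximable_lim f : measurable_fun [set: binseq] f ->
  (forall eps : R, 0 < eps -> exists g, [/\ measurable_fun [set: binseq] g,
    approximable g & (L1_dist P f g <= eps%:E)%E]) ->
  approximable f.
Proof.
move=> mf lim eps e0; have e20 : 0 < eps / 2 by rewrite divr_gt0.
have [g [mg ag fg]] := lim _ e20; have [n [H gH]] := ag _ e20.
exists n, H; rewrite [eps]splitr EFinD.
have mH := measurable_trace (@nat_of_ord n) H.
apply: le_trans (L1_dist_triangle P mf mg mH) _; exact: leeD.
Qed.

Lemma approximableD f g : measurable_fun [set: binseq] f ->
  measurable_fun [set: binseq] g ->
  approximable f -> approximable g -> approximable (f \+ g).
Proof.
move=> mf mg af ag eps e0; have e20 : 0 < eps / 2 by rewrite divr_gt0.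
have [n [H fH]] := af _ e20; have [m [K gK]] := ag _ e20.
have [H' HH'] := trace_widen H (leq_maxl n m).
have [K' KK'] := trace_widen K (leq_maxr n m).
rewrite HH' in fH; rewrite KK' in gK.
exists (maxn n m), (H' \+ K'); rewrite [eps]splitr EFinD.
have mH := measurable_trace (@nat_of_ord (maxn n m)) H'.
have mK := measurable_trace (@nat_of_ord (maxn n m)) K'.
exact: le_trans (L1_distD P mf mg mH mK) (leeD fH gK).
Qed.

Lemma approximableZ (k : R) f : measurable_fun [set: binseq] f ->
  approximable f -> approximable (fun x => k * f x).
Proof.
move=> mf af eps e0.
(* Adding 1 keeps the divisor positive even when [k] is 0. *)
have k0 : 0 < `|k| + 1 by rewrite ltr_wpDl.
have [n [H fH]] := af _ (divr_gt0 e0 k0).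
exists n, (fun w => k * H w).
rewrite /L1_dist; under eq_integral do rewrite /= -mulrBr normrM EFinM.
rewrite ge0_integralZl//; last first.
  by apply: measurable_dist => //; exact: measurable_trace.
apply: (@le_trans _ _ ((`|k| + 1)%:E * (eps / (`|k| + 1))%:E)%E).
  by apply: lee_pmul => //; [exact: integral_ge0|rewrite lee_fin lerDl].
by rewrite -EFinM mulrC divfK// gt_eqF.
Qed.

Lemma approximable_sum n (f : 'I_n -> binseq -> R) :
  (forall i, measurable_fun [set: binseq] (f i)) ->
  (forall i, approximable (f i)) -> approximable (fun x => \sum_(i < n) f i x).
Proof.
elim: n f => [|n IH] f mf af.
  have -> : (fun x => \sum_(i < 0) f i x) =
      (fun=> 0) \o trace (@nat_of_ord 0).
    by apply/funext => x; rewrite big_ord0.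
  exact: approximable_trace.
have -> : (fun x => \sum_(i < n.+1) f i x) =
    (fun x => \sum_(i < n) f (widen_ord (leqnSn n) i) x) \+ f ord_max.
  by apply/funext => x; rewrite big_ord_recr.
apply: approximableD => //; first exact: measurable_sum.
by apply: IH.
Qed.

(** The sets with approximable indicator form a lambda-system containing the cylinders: proper
    differences follow from linearity, increasing unions from continuity of [P]. *)
Lemma approximable_indic (A : set binseq) : measurable A ->
  approximable (\1_A : binseq -> R).
Proof.
rewrite measurable_cylinders.
suff : <<s cylinders >> `<=`
    [set A | measurable A /\ approximable (\1_A : binseq -> R)].
  by move=> /(_ A) + sA => /(_ sA)[].
have cyl B : cylinders B -> measurable B /\ approximable (\1_B : binseq -> R).
  move=> cB; split; first by rewrite measurable_cylinders; exact: sub_gen_smallest.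
  have [n /depends_on_trace ->] := cB.
  exact: (@approximable_trace n (\1_[set w | B (extend w)])).
apply: lambda_system_subset => //; first exact: cylinders_setI.
split=> //.
- by apply: cyl; exists 0%N.
- move=> A' B BA [mA aA] [mB aB]; split; first exact: measurableD.
  have -> : (\1_(A' `\` B) : binseq -> R) = \1_A' \+ (fun x => -1 * \1_B x).
    apply/funext => x /=; rewrite !indicE in_setD.
    case: (boolP (x \in B)) => xB /=.
      by rewrite (mem_set (BA _ (set_mem xB)))/= mulN1r subrr.
    by rewrite andbT mulr0 addr0.
  apply: approximableD => //; last exact: approximableZ.
  exact: measurable_funM.
- move=> F ndF GF; have mF i : measurable (F i) by case: (GF i).
  have mU : measurable (\bigcup_i F i) by exact: bigcup_measurable.
  split => //; apply: approximable_lim => // eps e0.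
  (* Continuity from below yields one [F N] whose difference from the union has measure at most
     [eps]. *)
  have /fine_cvg : P \o F @ \oo --> (fine (P (\bigcup_i F i)))%:E.
    by rewrite fineK ?fin_num_measure//; exact: nondecreasing_cvg_mu.
  move=> /cvgr_dist_le/(_ _ e0)[N _ /(_ N (leqnn N))/= PN].
  have FU : F N `<=` \bigcup_i F i by exact: bigcup_sup.
  have [mN aN] := GF N; exists (\1_(F N)); split => //.
  have -> : L1_dist P (\1_(\bigcup_i F i)) (\1_(F N)) =
      P (\bigcup_i F i `\` F N).
    transitivity (\int[P]_x (\1_(\bigcup_i F i `\` F N) x)%:E)%E; last first.
      by rewrite integral_indic ?setIT//; exact: measurableD.
    apply: eq_integral => x _; congr (_%:E); rewrite !indicE in_setD.
    case: (boolP (x \in F N)) => xN /=.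
      by rewrite (mem_set (FU _ (set_mem xN))) subrr normr0.
    by rewrite andbT subr0 normr_nat.
  have -> : P (\bigcup_i F i `\` F N) = (P (\bigcup_i F i) - P (F N))%E.
    by rewrite measureD// ?(ltey_eq, fin_num_measure)// setIidr.
  rewrite -[P (\bigcup_i F i)]fineK ?fin_num_measure//.
  rewrite -[P (F N)]fineK ?fin_num_measure// -EFinB lee_fin.
  exact: le_trans (ler_norm _) PN.
Qed.

(** Simple functions are dense in $L^1$, and they are finite combinations of indicators. *)
Lemma approximable_integrable (f : binseq -> R) :
  P.-integrable [set: binseq] (EFin \o f) -> approximable f.
Proof.
move=> intf; have mf : measurable_fun [set: binseq] f.
  by apply/measurable_EFinP; exact: measurable_int intf.
apply: approximable_lim => // eps e0.
have [g [intg _ /fine_cvgP[gfin]]] := approximation_sfun_integrable measurableT intf.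
move=> /cvgr_dist_le/(_ _ e0) near0.
have [N _ /(_ N (leqnn N))[gN fgN]] := filterI gfin near0.
exists (g N); split.
- exact: measurable_funPT.
- rewrite [X in approximable X](funext (fimfunEord (g N))).
  apply: approximable_sum => i.
    exact: measurable_funM.
  apply: approximableZ => //; exact: approximable_indic.
- move: fgN; rewrite sub0r normrN => fgN.
  change (\int[P]_z `|(EFin \o f) z - (g N z)%:E| <= eps%:E)%E.
  by rewrite -(fineK gN) lee_fin (le_trans (ler_norm _)).
Qed.

(** Replacing an approximant by its positive part does not increase its distance to a nonnegative
    function. *)
Lemma approximable_nonneg (f : binseq -> R) (eps : R) : L1_plus P f -> 0 < eps ->
  exists n (H : {ffun 'I_n -> bool} -> R), (forall w, 0 <= H w) /\
    (L1_dist P f (H \o trace (@nat_of_ord n)) <= eps%:E)%E.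
Proof.
move=> [f0 intf] e0; have mf : measurable_fun [set: binseq] f.
  by apply/measurable_EFinP; exact: measurable_int intf.
have [n [H fH]] := approximable_integrable intf e0.
exists n, (fun w => Num.max (H w) 0); split.
  by move=> w; rewrite le_max lexx orbT.
apply: le_trans fH; apply: ge0_le_integral => //.
- by apply: measurable_dist => //; exact: (measurable_trace _ (fun w => Num.max (H w) 0)).
- by apply: measurable_dist => //; exact: measurable_trace.
- move=> x _; rewrite lee_fin/=; have := f0 x.
  case: (leP 0 (H (trace (@nat_of_ord n) x))) => // Hlt0 fx0.
  rewrite subr0 ger0_norm// (le_trans _ (ler_norm _))//; lra.
Qed.

End approximable.

(** * The weak law of large numbers for the averaged densities *)

Section second_moment.
Context (R : realType) (q : nat -> bool -> R).
Hypothesis q_gt0 : forall i b, 0 < q i b.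
Hypothesis q_sum1 : forall i, \sum_b q i b = 1.
Context (N m : nat) (e : 'I_N * option 'I_m -> nat) (p : 'I_N -> bool -> R).
Hypothesis law_block : forall i k, q (e (i, Some k)) = p i.
Implicit Types (a : {ffun 'I_N -> bool}) (j : 'I_N -> option 'I_m).

Let q_neq0 i b : q i b != 0. Proof. by rewrite gt_eqF. Qed.

(* Index (i, None) stands for the i-th coordinate of the window and (i, Some k) for
   place k of its sub-block; j i = None leaves the i-th sub-block unconditioned. *)
Definition pin_ratio a j (t : 'I_N * option 'I_m) (b : bool) : R :=
  if t.2 is Some k
  then if j t.1 == Some k then (b == ~~ a t.1)%:R / q (e t) b else 1
  else (b == a t.1)%:R / q (e t) b.

(** The density, relative to the product measure, of that measure conditioned on the window being
    [a] and on the value [~~ a i] at each place selected by [j]. *)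
Definition pinned_density a j (w : {ffun 'I_N * option 'I_m -> bool}) : R :=
  \prod_t pin_ratio a j t (w t).

(** By independence the moment is a product over coordinates. Each window coordinate is pinned by
    both factors, while a place of a sub-block matters only where the two selections coincide. *)
Lemma mean_pinned_density2 a j j' :
  mean q e (fun w => pinned_density a j w * pinned_density a j' w) =
  \prod_i (q (e (i, None)) (a i))^-1 *
  \prod_i (if (j i == j' i) && (j i != None) then (p i (~~ a i))^-1 else 1).
Proof.
transitivity (mean q e (fun w => \prod_t (pin_ratio a j t (w t) * pin_ratio a j' t (w t)))).
  by congr mean; apply/funext => w; rewrite /pinned_density -big_split.
rewrite (mean_prod q e (fun t b => pin_ratio a j t b * pin_ratio a j' t b)).
pose F i o := \sum_b q (e (i, o)) b * (pin_ratio a j (i, o) b * pin_ratio a j' (i, o) b).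
transitivity (\prod_i \prod_o F i o).
  by rewrite pair_bigA; apply: eq_bigr => -[i o] _.
have q1 t : q t false + q t true = 1 by rewrite -[RHS](q_sum1 t) big_bool addrC.
(* A place pinned twice contributes the inverse of its weight; pinned at most once it contributes 1,
   since each ratio has mean 1. *)
have FS i k : F i (Some k) =
    if (j i == Some k) && (j' i == Some k) then (p i (~~ a i))^-1 else 1.
  rewrite /F big_bool /pin_ratio/= -(law_block i k).
  move: (q1 (e (i, Some k))) (q_neq0 (e (i, Some k)) true).
  move: (q_neq0 (e (i, Some k)) false).
  case: (j i == _); case: (j' i == _); case: (a i) => /= y0 xy x0;
    first [by field; rewrite ?x0 ?y0|by move: xy; lra].
have FN i : F i None = (q (e (i, None)) (a i))^-1.
  rewrite /F big_bool /pin_ratio/=.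
  move: (q_neq0 (e (i, None)) true) (q_neq0 (e (i, None)) false).
  by case: (a i) => /= x0 y0; field; rewrite ?x0 ?y0.
rewrite -big_split; apply: eq_bigr => i _ /=.
rewrite (bigD1 None)//= FN; congr (_ * _).
case ji : (j i) => [k|]/=; last first.
  by rewrite andbF big1// => -[k|]// _; rewrite FS ji.
rewrite (bigD1 (Some k))//= FS ji eqxx/= andbT eq_sym big1 ?mulr1//.
move=> -[k'|]//= kk'; rewrite FS ji (negbTE (_ : Some k != Some k'))//.
by rewrite eq_sym.
Qed.

(** By distributivity this average over all choices of one place per sub-block is the cylinder
    density times a product of empirical means. *)
Definition block_mean a w : R :=
  (m ^ N)%:R^-1 * \sum_(J : {ffun 'I_N -> 'I_m}) pinned_density a (fun i => Some (J i)) w.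

(** Expanding the square, the first term and the cross terms give [kappa] and [- 2 * kappa]; only
    the square of the average sees coincidences between places. *)
Lemma second_moment a : (0 < m)%N ->
  mean q e (fun w => (pinned_density a (fun=> None) w - block_mean a w) ^+ 2) =
  \prod_i (q (e (i, None)) (a i))^-1 *
  (\prod_i (1 + ((p i (~~ a i))^-1 - 1) / m%:R) - 1).
Proof.
move=> m0; have mR : m%:R != 0 :> R by rewrite pnatr_eq0 -lt0n.
pose none := (fun=> None) : 'I_N -> option 'I_m.
pose some (J : {ffun 'I_N -> 'I_m}) i := Some (J i).
set kappa := \prod_i (q (e (i, None)) (a i))^-1.
set M : R := (m ^ N)%:R.
have M0 : M != 0 by rewrite pnatr_eq0 -lt0n expn_gt0 m0.
have -> : (fun w => (pinned_density a none w - block_mean a w) ^+ 2) = (fun w =>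
    pinned_density a none w * pinned_density a none w + (- 2 * M^-1) *
      \sum_J pinned_density a none w * pinned_density a (some J) w + (M^-1 * M^-1) *
      \sum_J \sum_J' pinned_density a (some J) w * pinned_density a (some J') w).
  apply/funext => w; rewrite -big_distrr -big_distrlr/=.
  rewrite /block_mean -/M -/(some _); ring.
rewrite !meanD !meanZ mean_pinned_density2 -/kappa.
rewrite (mean_sum q e (fun J w => pinned_density a none w * pinned_density a (some J) w)).
rewrite (mean_sum q e (fun J w =>
  \sum_J' pinned_density a (some J) w * pinned_density a (some J') w)).
(* The selection [none] never coincides with a place, so each of the [M] cross terms equals
   [kappa]. *)
have -> : \sum_J mean q e (fun w => pinned_density a none w * pinned_density a (some J) w) =
    M * kappa.
  under eq_bigr => J _.
    rewrite mean_pinned_density2 [X in _ * X]big1 ?mulr1//; over.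
  by rewrite sumr_const card_ffun !card_ord mulr_natl.
(* The sum factors over [i]: among the [m * m] pairs of places, the [m] diagonal ones contribute the
   inverse weight and all others 1. *)
have -> : \sum_J mean q e (fun w => \sum_J' pinned_density a (some J) w * pinned_density a (some J') w) =
    kappa * \prod_i (m%:R * m%:R + m%:R * ((p i (~~ a i))^-1 - 1)).
  pose G i (k k' : 'I_m) : R := if k == k' then (p i (~~ a i))^-1 else 1.
  transitivity (\sum_(J : {ffun 'I_N -> 'I_m}) \sum_(J' : {ffun 'I_N -> 'I_m})
      kappa * \prod_i G i (J i) (J' i)).
    apply: eq_bigr => J _; rewrite (mean_sum q e (fun J' w =>
      pinned_density a (some J) w * pinned_density a (some J') w)).
    apply: eq_bigr => J' _; rewrite mean_pinned_density2; congr (_ * _).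
    by apply: eq_bigr => i _; rewrite andbT (inj_eq (@Some_inj _)).
  transitivity (\sum_(J : {ffun 'I_N -> 'I_m})
      kappa * \prod_i \sum_k' G i (J i) k').
    by apply: eq_bigr => J _; rewrite bigA_distr_bigA big_distrr.
  rewrite -big_distrr/= -(bigA_distr_bigA (fun i k => \sum_k' G i k k')).
  congr (_ * _).
  apply: eq_bigr => i _.
  transitivity (\sum_(k < m) (m%:R + ((p i (~~ a i))^-1 - 1))).
    apply: eq_bigr => k _; rewrite (bigD1 k)//= /G eqxx.
    rewrite (eq_bigr (fun=> 1)) => [|k' /negbTE kk']; last by rewrite eq_sym kk'.
    rewrite sumr_const cardC1 card_ord.
    have -> : (m%:R : R) = 1 + m.-1%:R by rewrite -[in LHS](prednK m0) -natr1 addrC.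
    ring.
  rewrite sumr_const card_ord -mulr_natl; ring.
rewrite [X in kappa * X + _ + _]big1 ?mulr1//.
have -> : \prod_i (m%:R * m%:R + m%:R * ((p i (~~ a i))^-1 - 1)) =
   M * M * \prod_i (1 + ((p i (~~ a i))^-1 - 1) / m%:R).
  have -> : M = \prod_(i < N) m%:R by rewrite prodr_const card_ord -natrX.
  rewrite -!big_split; apply: eq_bigr => i _ /=.
  by move: (p i (~~ a i))^-1 => c; field.
by field.
Qed.

End second_moment.

(** Makes the second moment linear in the small parameter, with a constant depending only on the
    length of the window. *)
Lemma prod1D_le (R : realType) (n : nat) (x : 'I_n -> R) (y : R) :
  0 <= y <= 1 -> (forall i, 0 <= x i <= y) ->
  \prod_i (1 + x i) - 1 <= 2 ^+ n * y.
Proof.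
move=> /andP[y0 y1] xy; rewrite lerBlDl.
apply: (@le_trans _ _ (\prod_(i < n) (1 + y))).
  apply: ler_prod => i _; have /andP[xi0 xiy] := xy i.
  by rewrite addr_ge0//= lerD2l.
rewrite prodr_const card_ord.
(* convexity of [(1 + y) ^+ n] on [0, 1] *)
apply: (@le_trans _ _ (1 + (2 ^+ n - 1) * y)); last first.
  by rewrite lerD2l ler_wpM2r// lerBlDr lerDl.
elim: n {x xy} => [|n IH]; first by rewrite !expr0 subrr mul0r addr0.
rewrite !exprS; apply: (le_trans (ler_wpM2l _ IH)); first by rewrite addr_ge0.
have z1 : 0 <= 2 ^+ n - 1 :> R by rewrite subr_ge0 exprn_ege1// ler1n.
move: z1; move: (2 ^+ n) => z z1.
rewrite -subr_ge0.
have -> : 1 + (2 * z - 1) * y - (1 + y) * (1 + (z - 1) * y) =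
  (z - 1) * (y * (1 - y)) by ring.
by rewrite !mulr_ge0// subr_ge0.
Qed.

(** * Permutations carrying the source measure to the pinned measures *)

Section orbit.
Context (R : realType) (q : nat -> bool -> R).
Hypothesis q_gt0 : forall i b, 0 < q i b.
Context (N m : nat) (e : 'I_N * option 'I_m.+1 -> nat).
Context (p : 'I_N -> bool -> R).
Hypothesis law_block : forall i k, q (e (i, Some k)) = p i.

(* The one-coordinate laws of the measure f nu, as weights. *)
Definition source (t : 'I_N * option 'I_m.+1) (b : bool) : R :=
  if t.2 is Some k then if k == ord0 then b%:R else q (e t) b else (~~ b)%:R.

(** Each index is sent to the one whose law it receives: with products read from left to right,
    place [k] goes to place 0, and from there to the window coordinate if [c] holds. *)
Definition fiber_perm (c : bool) (k : 'I_m.+1) : {perm option 'I_m.+1} :=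
  (tperm (Some ord0) (Some k) * (if c then tperm None (Some ord0) else 1))%g.

Definition move_fun (a : {ffun 'I_N -> bool}) (J : {ffun 'I_N -> 'I_m.+1})
  (t : 'I_N * option 'I_m.+1) := (t.1, fiber_perm (a t.1) (J t.1) t.2).

Lemma move_fun_inj a J : injective (move_fun a J).
Proof. by move=> [i o] [i' o'] [<-] /perm_inj <-. Qed.

Definition move_perm a J : {perm 'I_N * option 'I_m.+1} :=
  perm (@move_fun_inj a J).

Lemma source_move_perm a J t b :
  source (move_perm a J t) b / q (e t) b = pin_ratio q e a (fun i => Some (J i)) t b.
Proof.
have qd u c : q u c / q u c = 1 by rewrite divff// gt_eqF.
rewrite permE /move_fun; case: t => i o; rewrite /pin_ratio /source /fiber_perm/=.
rewrite permM; case: o => [k|]; last first.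
  rewrite tpermD//; case: (a i); first by rewrite tpermL; case: b.
  by rewrite perm1; case: b.
have [<-|Jk] := eqVneq (Some (J i)) (Some k).
  rewrite tpermR; case: (a i); first by rewrite tpermR; case: b.
  by rewrite perm1 eqxx; case: b.
(* Place 0, when it is not the chosen place, receives the unconditioned law of place [J i]; this
   equals its own because the laws agree along a sub-block. *)
have [k0|k0] := eqVneq k ord0.
  rewrite {}k0 in Jk *.
  have -> : tperm (Some ord0) (Some (J i)) (Some ord0) = Some (J i).
    by rewrite tpermL.
  have J0 : J i != ord0 by apply: contra_neq Jk => ->.
  have -> : (if a i then tperm None (Some ord0) else 1%g) (Some (J i)) = Some (J i).
    by case: (a i); rewrite ?perm1// tpermD// (inj_eq (@Some_inj _)) eq_sym.
  by rewrite (negbTE J0) !law_block -(law_block i ord0) qd.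
rewrite tpermD//; last first.
  by apply: contra_neq k0 => -[].
have -> : (if a i then tperm None (Some ord0) else 1%g) (Some k) = Some k.
  case: (a i); rewrite ?perm1// tpermD//.
  by apply: contra_neq k0 => -[].
by rewrite (negbTE k0) qd.
Qed.

End orbit.

(** * Approximate transitivity from long sub-blocks of equal laws *)

Section product_measure_AT.
Context (R : realType) (q : nat -> bool -> R) (P : probability binseq R).
Hypothesis q_gt0 : forall i b, 0 < q i b.
Hypothesis q_sum1 : forall i, \sum_b q i b = 1.
Hypothesis PE : forall n (A : nat -> pred bool),
  P [set x | forall i, (i < n)%N -> A i (x i)] =
  (\prod_(i < n) \sum_(b | A i b) q i b)%:E.

(** The largest of the finitely many individual windows serves all the functions at once. *)
Lemma common_approximation n (f_ : 'I_n -> binseq -> R) (eps : R) :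
  (forall j, L1_plus P (f_ j)) -> 0 < eps ->
  exists N (H : 'I_n -> {ffun 'I_N -> bool} -> R),
    (forall j w, 0 <= H j w) /\
    forall j, (L1_dist P (f_ j) (H j \o trace (@nat_of_ord N)) <= eps%:E)%E.
Proof.
move=> L1f e0; pose N_of j := approximable_nonneg (L1f j) e0.
have /fin_all_exists[N_ N_P] := N_of.
pose N := \max_j N_ j.
have : forall j, exists H : {ffun 'I_N -> bool} -> R, (forall w, 0 <= H w) /\
    (L1_dist P (f_ j) (H \o trace (@nat_of_ord N)) <= eps%:E)%E.
  move=> j; have [H [H0 fH]] := N_P j.
  have jN : (N_ j <= N)%N by exact: leq_bigmax.
  exists (fun w => H [ffun i => w (widen_ord jN i)]); split => //.
  apply: le_trans fH; rewrite le_eqVlt; apply/orP; left; apply/eqP.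
  by congr L1_dist; apply/funext => x /=; congr H; apply/ffunP => i; rewrite !ffunE.
by move=> /fin_all_exists[H HP]; exists N, H; split=> j; have [] := HP j.
Qed.

(** Passes from the second moment to the $L^1$ norm that approximate transitivity requires. *)
Lemma mean_norm_le (T : finType) (e : T -> nat) (H : {ffun T -> bool} -> R)
    (eta : R) : 0 < eta ->
  mean q e (fun w => H w ^+ 2) <= eta ^+ 2 -> mean q e (fun w => `|H w|) <= eta.
Proof.
move=> eta0 H2; have d0 : 0 < 2 * eta by rewrite mulr_gt0.
(* AM-GM: [y <= eta / 2 + y ^+ 2 / (2 * eta)] *)
apply: (@le_trans _ _ (mean q e (fun w => eta / 2 + (2 * eta)^-1 * H w ^+ 2))).
  apply: le_mean => // w; rewrite -real_normK ?num_real//.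
  move: (normr_ge0 (H w)); move: `|H w| => y y0.
  rewrite -subr_ge0.
  have -> : eta / 2 + (2 * eta)^-1 * y ^+ 2 - y = (2 * eta)^-1 * (y - eta) ^+ 2.
    by field; rewrite gt_eqF.
  by rewrite mulr_ge0 ?sqr_ge0// invr_ge0 ltW.
rewrite meanD mean_cst// meanZ.
apply: (@le_trans _ _ (eta / 2 + (2 * eta)^-1 * eta ^+ 2)).
  by rewrite lerD2l ler_wpM2l// invr_ge0 ltW.
by rewrite le_eqVlt; apply/orP; left; apply/eqP; field; rewrite gt_eqF.
Qed.

(** The last condition on the sub-blocks makes the variance of each empirical mean at most [delta];
    the second moment bound then controls all cylinders of the window simultaneously. *)
Lemma approximately_transitive_product :
  (forall N (delta : R), 0 < delta -> exists m
     (e : 'I_N * option 'I_m.+1 -> nat) (p : 'I_N -> bool -> R),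
     [/\ injective e, forall i, e (i, None) = i,
         forall i k, q (e (i, Some k)) = p i &
         forall i b, (p i b)^-1 / m.+1%:R <= delta]) ->
  approximately_transitive P natural_action.
Proof.
move=> blocks; split; first exact: (nonsingular_natural_action q_gt0 q_sum1 PE).
move=> n f_ eps L1f eps0.
have eps20 : 0 < eps / 2 by rewrite divr_gt0.
have [N [H [H0 fH]]] := common_approximation L1f eps20.
pose wt (a : {ffun 'I_N -> bool}) := \prod_(i < N) q i (a i).
have wt0 a : 0 < wt a by apply: prodr_gt0.
(* The mass that [H j] puts on the cylinder [a], that is, its coefficient on the normalized
   indicator of that cylinder. *)
pose c j a := H j a * wt a.
have c0 j a : 0 <= c j a by rewrite mulr_ge0// ltW.
pose C := \sum_j \sum_a c j a.
have C0 : 0 <= C by apply: sumr_ge0 => j _; apply: sumr_ge0.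
(* The error allowed per normalized cylinder: the coefficients sum to at most [C], so the total
   stays within [eps / 2]. The added 1 keeps the denominator positive. *)
pose eta := eps / 2 / (C + 1).
have C10 : 0 < C + 1 by rewrite ltr_wpDl.
have eta0 : 0 < eta by rewrite divr_gt0.
pose K := \sum_a (wt a)^-1.
have wtV0 a : 0 <= (wt a)^-1 by rewrite invr_ge0 ltW.
have K0 : 0 <= K by apply: sumr_ge0.
pose D := K * 2 ^+ N + 1.
have D0 : 0 < D by rewrite ltr_wpDl// mulr_ge0// exprn_ge0.
(* [K] dominates every inverse cylinder mass, so the second moments are at most
   [K * 2 ^+ N * delta], hence at most [eta ^+ 2]; the bound by 1 is the range of the convexity
   estimate. *)
pose delta := Num.min 1 (eta ^+ 2 / D).
have delta0 : 0 < delta by rewrite lt_min ltr01 divr_gt0// exprn_gt0.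
have delta1 : delta <= 1 by rewrite ge_min lexx.
have [m [e [p [e_inj eN law_block small]]]] := blocks N delta delta0.
pose F (w : {ffun 'I_N * option 'I_m.+1 -> bool}) : R :=
  \prod_t (source q e t (w t) / q (e t) (w t)).
have source0 t b : 0 <= source q e t b.
  rewrite /source; case: t => i [k|]/=; last by case: b.
  by case: eqP => _; [case: b|rewrite ltW].
have L1F : L1_plus P (F \o trace e).
  split; last first.
    exact: (integrable_trace P e F).
  by move=> x; apply: prodr_ge0 => t _; rewrite divr_ge0// ltW.
pose I : finType := ({ffun 'I_N -> bool} * {ffun 'I_N -> 'I_m.+1})%type.
have /fin_all_exists[g gP] (aJ : I) := Sinf_extend (move_perm aJ.1 aJ.2) e_inj.
pose Z a w := pinned_density q e a (fun=> None) w.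
pose ZJ (aJ : I) w := pinned_density q e aJ.1 (fun i => Some (aJ.2 i)) w.
have beta_g aJ : ae_eq P [set: binseq] (beta P natural_action (g aJ) (F \o trace e))
    (EFin \o (ZJ aJ \o trace e)).
  have [ge gN] := gP aJ.
  have := beta_prod q_gt0 q_sum1 PE (source q e) e_inj ge gN.
  have -> : (fun x : binseq => \prod_t (source q e t (x (e t)) / q (e t) (x (e t)))) =
      F \o trace e.
    by apply/funext => x; apply: eq_bigr => t _; rewrite ffunE.
  apply: filterS => x bx xT; rewrite (bx xT); congr (_%:E).
  apply: eq_bigr => t _; rewrite ffunE.
  exact: (source_move_perm q_gt0 law_block).
(* The mass of each cylinder is shared equally among all choices of places. *)
pose lam j (k : 'I_#|I|) := c j (enum_val k).1 / (m.+1 ^ N)%:R.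
exists (F \o trace e), #|I|, (fun k => g (enum_val k)), lam; split => //.
  by move=> j k; rewrite /lam divr_ge0.
move=> j; rewrite Lnorm1.
pose S w := \sum_a c j a * block_mean q e a w.
have SE w : \sum_(k < #|I|) lam j k * ZJ (enum_val k) w = S w.
  rewrite -(big_enum_val (A := I) (fun aJ => c j aJ.1 / (m.+1 ^ N)%:R * ZJ aJ w)).
  rewrite (eq_bigl xpredT)//.
  rewrite -(pair_bigA _ (fun a J => c j a / (m.+1 ^ N)%:R * ZJ (a, J) w))/=.
  by apply: eq_bigr => a _; rewrite /block_mean mulrA big_distrr.
have mf : measurable_fun [set: binseq] (f_ j).
  by apply/measurable_EFinP; case: (L1f j) => _ /(measurable_int P).
have mF : measurable_fun [set: binseq] (F \o trace e) by exact: measurable_trace.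
have mS : measurable_fun [set: binseq] (S \o trace e) by exact: measurable_trace.
have mH : measurable_fun [set: binseq] (H j \o trace (@nat_of_ord N)).
  exact: measurable_trace.
have -> : (\int[P]_y `|(f_ j y)%:E - \sum_(k < #|I|) (lam j k)%:E *
      beta P natural_action (g (enum_val k)) (F \o trace e) y| =
    L1_dist P (f_ j) (S \o trace e))%E.
  apply: ae_eq_integral => //.
  - apply: measurableT_comp => //; apply: emeasurable_funB.
      exact/measurable_EFinP.
    apply: (emeasurable_sum _ (h := fun k y => ((lam j k)%:E *
      beta P natural_action (g (enum_val k)) (F \o trace e) y)%E)) => k.
    apply: measurable_funeM.
    exact: (measurable_beta q_gt0 q_sum1 PE).
  - exact: measurable_dist.
  (* Each translate is known only almost everywhere; the finitely many exceptional sets are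
     discarded together. *)
  - have bg : {ae P, forall y, forall k : 'I_#|I|, [set: binseq] y ->
        beta P natural_action (g (enum_val k)) (F \o trace e) y =
        (ZJ (enum_val k) (trace e y))%:E}.
      by apply: filter_forall => k; exact: beta_g.
    apply: filterS bg => y by_ yT.
    under eq_bigr => k _ do rewrite (by_ k yT) -EFinM.
    by rewrite sumEFin SE.
apply: (le_trans (L1_dist_triangle P mf mH mS)).
rewrite [eps]splitr EFinD; apply: leeD (fH j) _.
(* Only the cylinder containing [x] contributes, and there the normalization cancels [wt a]. *)
have HE x : H j (trace (@nat_of_ord N) x) = \sum_a c j a * Z a (trace e x).
  have ZE a : Z a (trace e x) = \prod_(i < N) ((x i == a i)%:R / q i (x i)).
    rewrite /Z /pinned_density.
    transitivity (\prod_i \prod_o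
        pin_ratio q e a (fun=> None) (i, o) (trace e x (i, o))).
      by rewrite pair_bigA; apply: eq_bigr => -[i o].
    apply: eq_bigr => i _; rewrite (bigD1 None)//= big1 ?mulr1; last by case.
    by rewrite /pin_ratio/= ffunE eN.
  rewrite (bigD1 (trace (@nat_of_ord N) x))//= big1 ?addr0 => [|a ax].
    rewrite ZE /c -mulrA -[LHS]mulr1; congr (_ * _).
    rewrite /wt -big_split big1// => i _ /=.
    by rewrite ffunE eqxx mul1r divff// gt_eqF.
  have [i xi] : exists i : 'I_N, x i != a i.
    apply/existsP; apply: contraR ax; rewrite negb_exists => /forallP xa.
    by apply/eqP/ffunP => i; rewrite ffunE; have := xa i; rewrite negbK => /eqP.
  by rewrite ZE (bigD1 i)//= (negbTE xi) !mul0r mulr0.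
have -> : L1_dist P (H j \o trace (@nat_of_ord N)) (S \o trace e) =
    (mean q e (fun w => `|\sum_a c j a * (Z a w - block_mean q e a w)|))%:E.
  rewrite -(integral_trace q_sum1 PE e_inj (fun w => `|\sum_a c j a * (Z a w - block_mean q e a w)|)).
  apply: eq_integral => x _; rewrite /= HE /S -sumrB.
  by congr (`|_|%:E); apply: eq_bigr => a _; rewrite mulrBr.
rewrite lee_fin.
apply: (@le_trans _ _ (mean q e (fun w => \sum_a c j a * `|Z a w - block_mean q e a w|))).
  apply: le_mean => // w; apply: le_trans (ler_norm_sum _ _ _) _.
  by apply: ler_sum => a _; rewrite normrM ger0_norm.
rewrite (mean_sum q e (fun a w => c j a * `|Z a w - block_mean q e a w|)).
apply: (@le_trans _ _ (\sum_a c j a * eta)).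
  apply: ler_sum => a _; rewrite meanZ ler_wpM2l//.
  apply: mean_norm_le => //.
  rewrite (second_moment q_gt0 q_sum1 law_block)//.
  have pinv i b : 1 <= (p i b)^-1.
    rewrite -(law_block i ord0) invf_ge1// -(q_sum1 (e (i, Some ord0))).
    by rewrite (bigD1 b)//= lerDl sumr_ge0// => b' _; rewrite ltW.
  have -> : \prod_i (q (e (i, None)) (a i))^-1 = (wt a)^-1.
    by rewrite /wt prodfV; congr (_^-1); apply: eq_bigr => i _; rewrite eN.
  apply: (@le_trans _ _ (K * (2 ^+ N * delta))).
    apply: (@le_trans _ _ ((wt a)^-1 * (2 ^+ N * delta))).
      rewrite ler_wpM2l// prod1D_le// ?(ltW delta0)// => i.
      rewrite divr_ge0 ?subr_ge0//=; apply: le_trans (small i (~~ a i)).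
      by rewrite ler_wpM2r ?invr_ge0// lerBlDr lerDl.
    rewrite ler_wpM2r ?mulr_ge0 ?exprn_ge0 ?(ltW delta0)//.
    by rewrite /K (bigD1 a)//= lerDl sumr_ge0.
  have : delta <= eta ^+ 2 / D by rewrite ge_min lexx orbT.
  rewrite ler_pdivlMr// mulrA => /(le_trans _); apply.
  by rewrite mulrC ler_wpM2l ?(ltW delta0)// lerDl.
rewrite -big_distrl/= /eta mulrCA ler_piMr ?(ltW eps20)//.
rewrite ler_pdivrMr// mul1r (@le_trans _ _ C)// ?lerDl//.
rewrite /C (bigD1 j)//= lerDl sumr_ge0// => j' _; exact: sumr_ge0.
Qed.

End product_measure_AT.

(** * The measure of the theorem and the choice of a far block *)

Definition nu_weight (R : realType) (l : R) (b : bool) : R :=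
  if b then l / (1 + l) else 1 / (1 + l).

Lemma nu_weight_gt0 (R : realType) (l : R) b : 0 < l -> 0 < nu_weight l b.
Proof. by move=> l0; case: b; rewrite divr_gt0// addr_gt0. Qed.

Lemma nu_weight_sum1 (R : realType) (l : R) : 0 < l -> \sum_b nu_weight l b = 1.
Proof.
by move=> l0; rewrite big_bool/= -mulrDl addrC divff// gt_eqF// addr_gt0.
Qed.

(** The inverse weights are [(1 + l) / l] and [1 + l]; both are at most [2 / l] since [l <= 1]. *)
Lemma nu_weight_inv (R : realType) (l : R) b : 0 < l -> l <= 1 ->
  (nu_weight l b)^-1 <= 2 / l.
Proof.
move=> l0 l1; have l10 : 0 < 1 + l by rewrite addr_gt0.
case: b; rewrite /nu_weight invf_div.
  by rewrite ler_pM2r ?invr_gt0//; lra.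
by rewrite divr1 ler_pdivlMr//; nra.
Qed.

Lemma nu_factor_weight (R : realType) (l : R) (A : pred bool) : 0 < l ->
  nu_factor l [set b | A b] = (\sum_(b | A b) nu_weight l b)%:E.
Proof.
move=> l0; have [nuF nuT] := nu_factorE l0.
rewrite big_mkcond big_bool/=.
have [At|At] := boolP (A true); have [Af|Af] := boolP (A false).
- have -> : [set b | A b] = setT by apply/seteqP; split=> -[] //=.
  by rewrite probability_setT; have := nu_weight_sum1 l0; rewrite big_bool => ->.
- have -> : [set b | A b] = [set true].
    by apply/seteqP; split=> -[]//=; rewrite (negbTE Af).
  by rewrite nuT addr0.
- have -> : [set b | A b] = [set false].
    by apply/seteqP; split=> -[]//=; rewrite (negbTE At).
  by rewrite nuF add0r.
- have -> : [set b | A b] = set0.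
    by apply/seteqP; split=> -[]//=; rewrite ?(negbTE At) ?(negbTE Af).
  by rewrite measure0 addr0.
Qed.

(** Otherwise [M] would bound the tail, and the finitely many earlier terms are bounded by their
    sum, so the supremum would be finite. *)
Lemma far_large_term (R : realType) (u : nat -> R) (N : nat) (M : R) :
  (forall n, 0 <= u n) ->
  ereal_sup [set (u n)%:E | n in [set: nat]] = +oo%E ->
  exists2 n, (N <= n)%N & M < u n.
Proof.
move=> u0 supu; apply: contrapT => noN.
suff : (ereal_sup [set (u n)%:E | n in [set: nat]] <=
    (`|M| + \sum_(i < N) u i)%:E)%E by rewrite supu.
apply: ge_ereal_sup => _ [n _ <-]; rewrite lee_fin.
have S0 : 0 <= \sum_(i < N) u i by apply: sumr_ge0.
have [Nn|nN] := leqP N n.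
  rewrite (@le_trans _ _ M)//; last by rewrite (le_trans (ler_norm _))// lerDl.
  by rewrite leNgt; apply/negP => Mu; apply: noN; exists n.
rewrite (bigD1 (Ordinal nN))//= addrCA lerDl addr_ge0// sumr_ge0//.
Qed.

Theorem theorem3p2 (R : realType) (L : nat -> nat) (lambda : nat -> R)
    (nu : probability binseq R)
    (L_gt0 : forall n, (0 < L n)%N)
    (lambda_gt0 : forall n, 0 < lambda n)
    (lambda_le1 : forall n, lambda n <= 1)
    (nuE : is_nu L lambda nu)
    (supL : ereal_sup [set ((L n)%:R * lambda n)%:E | n in [set: nat]] = +oo%E) :
  approximately_transitive nu natural_action.
Proof.
pose q i := nu_weight (lambda (block L i)).
apply: (@approximately_transitive_product R q).
- by move=> i b; exact: nu_weight_gt0.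
- by move=> i; exact: nu_weight_sum1.
- move=> n A; rewrite (nuE n (fun i => [set b | A i b])) -prodEFin.
  by apply: eq_bigr => i _; exact: nu_factor_weight.
move=> N delta delta0.
have u0 n : 0 <= (L n)%:R * lambda n by rewrite mulr_ge0// ltW.
(* Cutting the block into [N.+1] pieces, one more than the window length, avoids division by zero;
   the summand 1 absorbs the rounding in [m], as [lambda n <= 1]. *)
have [n Nn Ln] := far_large_term N (N.+1%:R * (2 / delta + 1)) u0 supL.
pose m := (L n %/ N.+1)%N.
have m_large : 2 / delta < m%:R * lambda n.
  have : (L n)%:R < m.+1%:R * N.+1%:R :> R by rewrite -natrM ltr_nat ltn_ceil.
  rewrite -(ltr_pM2r (lambda_gt0 n)) => /(lt_trans Ln).
  rewrite [m.+1%:R * _]mulrC -mulrA ltr_pM2l ?ltr0n// -natr1 mulrDl mul1r.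
  by move: (lambda_le1 n); lra.
have m0 : (0 < m)%N.
  rewrite lt0n; apply: contraTneq m_large => ->.
  by rewrite mul0r -leNgt divr_ge0// ltW.
have mE : m.-1.+1 = m by rewrite prednK.
(* The first coordinate of block [n]. Blocks are nonempty, so [N <= n] puts it past the window. *)
pose k0 := (\sum_(i < n) L i)%N.
have k0N : (N <= k0)%N.
  apply: (leq_trans Nn); rewrite -[n in (n <= _)%N]card_ord -sum1_card.
  exact: leq_sum.
(* Consecutive sub-blocks of length [m] from the start of block [n]; they fit because [N.+1 * m] is
   at most [L n]. *)
pose e (t : 'I_N * option 'I_m.-1.+1) : nat :=
  if t.2 is Some k then (k0 + (t.1 * m + k))%N else t.1.
have eb i k : block L (e (i, Some k)) = n.
  apply: blockP => //; rewrite /e/= leq_addr big_ord_recr/= ltn_add2l.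
  have km : (k < m)%N by rewrite -[m in (_ < m)%N]mE.
  apply: (@leq_trans (i.+1 * m)%N); first by rewrite mulSn addnC ltn_add2r.
  apply: (@leq_trans (N.+1 * m)%N); last by rewrite mulnC leq_trunc_div.
  by rewrite leq_mul2r ltnS (ltnW (ltn_ord i)) orbT.
exists m.-1, e, (fun=> nu_weight (lambda n)); split => //.
(* Window coordinates lie before [k0], and Euclidean division by [m] recovers the sub-block and the
   place. *)
- have lt_k0 (i : 'I_N) x : (i = k0 + x :> nat)%N -> False.
    by move=> ik; have := leq_trans (ltn_ord i) k0N; rewrite ik ltnNge leq_addr.
  move=> [i [k|]] [i' [k'|]]; rewrite /e/=.
  + move=> /addnI ee.
    have km (l : 'I_m.-1.+1) : (l < m)%N by rewrite -[m in (_ < m)%N]mE.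
    have ii : i = i' :> nat.
      have := congr1 (divn^~ m) ee.
      by rewrite /= !divnMDl// !divn_small// !addn0.
    move: ee; rewrite ii => /addnI /val_inj ->; congr (_, _); exact: val_inj.
  + by move=> /esym/lt_k0.
  + by move=> /lt_k0.
  + by move=> /val_inj ->.
- by move=> i k; rewrite /q eb.
- move=> i b; rewrite mE; apply: (@le_trans _ _ (2 / lambda n / m%:R)).
    by rewrite ler_wpM2r// nu_weight_inv.
  rewrite -mulrA -invfM ler_pdivrMr ?mulr_gt0 ?ltr0n//.
  by rewrite mulrC -ler_pdivrMr// [_ * m%:R]mulrC ltW.
Qed.
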